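(* If $r\ge3$ and $2\le u,v\le r$, then the vincular patterns $1\cdots(u-1)(u+1)\cdots(r+1)\text{-}u$ and $1\cdots(v-1)(v+1)\cdots(r+1)\text{-}v$ are Wilf-equivalent.
   Context: For $k\ge1$ let $[k]=\{1,\dots,k\}$; a $k$-ary word of length $n$ is an element of $[k]^n$. Two words are order-isomorphic if replacing the $i$-th smallest distinct letter by $i$ yields the same word. The vincular pattern $\alpha_1\cdots\alpha_r\text{-}\alpha_{r+1}$ (here $\alpha_1\cdots\alpha_r$ is the strictly increasing sequence $1,\dots,u-1,u+1,\dots,r+1$ and $\alpha_{r+1}=u$) occurs in a word $w=w_1\cdots w_n$ if there are indices $p$ and $q>p+r-1$ such that $w_pw_{p+1}\cdots w_{p+r-1}w_q$ is order-isomorphic to $\alpha_1\cdots\alpha_{r+1}$; otherwise $w$ avoids it. For a pattern $\sigma$, $a_\sigma(n,k)$ is the number of words in $[k]^n$ avoiding $\sigma$; $\sigma\sim\tau$ (Wilf-equivalence) means $a_\sigma(n,k)=a_\tau(n,k)$ for all $n\ge0,k\ge1$. *)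

(* Defs.v *)
From mathcomp Require Import all_boot.

Set Implicit Arguments.
Unset Strict Implicit.
Unset Printing Implicit Defensive.

(* Replaces each occurrence of the i-th smallest distinct letter by i,
   counting i from 1. *)
Definition standardize (s : seq nat) : seq nat :=
  [seq (index x (sort leq (undup s))).+1 | x <- s].

Definition order_isomorphic (s t : seq nat) : bool :=
  standardize s == standardize t.

(* (alpha, b) stands for the vincular pattern alpha-b: the letters of alpha must
   be matched by consecutive positions, the letter b by any later position. *)
Definition vincular_pattern : Type := (seq nat * nat)%type.

(* Positions p and q are counted from 0. *)
Definition occurs (sigma : vincular_pattern) (w : seq nat) : bool :=
  let r := size sigma.1 in
  [exists p : 'I_(size w), exists q : 'I_(size w),
     (p + r <= q) &&
     order_isomorphic (rcons (take r (drop p w)) (nth 0 w q))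
                      (rcons sigma.1 sigma.2)].

Definition avoids (sigma : vincular_pattern) (w : seq nat) : bool :=
  ~~ occurs sigma w.

(* An element i of 'I_k encodes the letter i + 1 of [k] = {1, ..., k}. *)
Definition letters (n k : nat) (w : n.-tuple 'I_k) : seq nat :=
  [seq i.+1 | i : 'I_k <- w].

Definition num_avoiding (sigma : vincular_pattern) (n k : nat) : nat :=
  #|[set w : n.-tuple 'I_k | avoids sigma (letters w)]|.

Definition wilf_equivalent (sigma tau : vincular_pattern) : Prop :=
  forall n k : nat, 1 <= k -> num_avoiding sigma n k = num_avoiding tau n k.

(* 1 ... (u-1) (u+1) ... (r+1) - u, for 1 <= u <= r + 1 *)
Definition gap_pattern (r u : nat) : vincular_pattern :=
  (iota 1 u.-1 ++ iota u.+1 (r.+1 - u), u).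

(* Main.v *)
Require Import Defs.
From mathcomp Require Import all_boot zify.

Set Implicit Arguments.
Unset Strict Implicit.
Unset Printing Implicit Defensive.

(* An occurrence of the pattern is a strictly increasing window of r consecutive
   letters together with a later letter lying strictly between its letters u-1
   and u. Cut a word into maximal strictly increasing runs. A run
   A_1 < ... < A_m constrains the rest of the word in two ways: the next run
   starts with a letter at most A_m, and, if m >= r, no later letter lies in one
   of the m-r+1 consecutive gaps of A beginning with the gap (A_{u-1}, A_u). The
   letters of A remain available, so the number of continuations depends only on
   the number of available letters and on how many of them exceed A_m. Passing
   from u to u+1 shifts the block of forbidden gaps by one, which amounts to
   exchanging the sizes of two inner gaps of A; this keeps A_1, A_m, m and the
   number of letters made unavailable. *)

(** * Strictly increasing sequences and standardization *)

Lemma ltn_nth_sorted (s : seq nat) i j :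
  sorted ltn s -> i < size s -> j < size s ->
  (nth 0 s i < nth 0 s j) = (i < j).
Proof.
move=> ss si sj; have H := sorted_ltn_nth ltn_trans 0 ss.
case: (ltngtP i j) => [ij|ji|->]; last by rewrite ltnn.
- by apply: H; rewrite ?inE.
- by apply/negbTE; rewrite -leqNgt ltnW //; apply: H; rewrite ?inE.
Qed.

Lemma uniq_ltn_sorted (s : seq nat) : sorted ltn s -> uniq s.
Proof. by rewrite ltn_sorted_uniq_leq => /andP[]. Qed.

Lemma eq_nth_sorted (s : seq nat) i j :
  sorted ltn s -> i < size s -> j < size s ->
  (nth 0 s i == nth 0 s j) = (i == j).
Proof. by move=> /uniq_ltn_sorted us si sj; rewrite nth_uniq. Qed.

Lemma eq_sorted_ltn (s t : seq nat) :
  sorted ltn s -> sorted ltn t -> s =i t -> s = t.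
Proof. exact: (irr_sorted_eq ltn_trans ltnn). Qed.

(** Inserting [x] at index [u.-1] of [a] gives the sorted list of letters, so entries before it have
    rank index plus one, [x] has rank [u], and later entries move up by one more. *)
Lemma standardize_rcons_gap (a : seq nat) x r u :
  size a = r -> 2 <= u <= r -> sorted ltn a ->
  nth 0 a u.-2 < x < nth 0 a u.-1 ->
  standardize (rcons a x) = rcons (iota 1 u.-1 ++ iota u.+1 (r.+1 - u)) u.
Proof.
move=> sa /andP[u2 ur] ss /andP[x1 x2].
have sz : size (take u.-1 a) = u.-1 by rewrite size_takel; lia.
set t := take u.-1 a ++ x :: drop u.-1 a.
have st : size t = r.+1 by rewrite size_cat /= sz size_drop; lia.
have tn i : nth 0 t i = if i < u.-1 then nth 0 a i else
                        if i == u.-1 then x else nth 0 a i.-1.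
  rewrite nth_cat sz; case: ltnP => ui; first by rewrite nth_take.
  case: eqP => [->|ne]; first by rewrite subnn.
  have -> : i - u.-1 = (i.-1 - u.-1).+1 by lia.
  by rewrite /= nth_drop; congr nth; lia.
have tS : sorted ltn t.
  apply/(sortedP 0) => i; rewrite st => ir; rewrite !tn.
  have H j k : j < k -> k < r -> nth 0 a j < nth 0 a k.
    by move=> jk kr; rewrite ltn_nth_sorted ?sa //; lia.
  case: (ltngtP i.+1 u.-1) => h.
  - by apply: H; lia.
  - case: eqP => [e|ne] /=; first by rewrite e.
    by apply: H; lia.
  - by have -> : i = u.-2 by lia.
have E : sort leq (undup (rcons a x)) = t.
  apply: eq_sorted_ltn => //.
    by rewrite ltn_sorted_uniq_leq sort_uniq undup_uniq (sort_sorted leq_total).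
  move=> y; rewrite mem_sort mem_undup mem_rcons mem_cat !inE -{1}(cat_take_drop u.-1 a) mem_cat.
  by case: (y == x); rewrite ?orbT.
rewrite /standardize E map_rcons.
have xi i : i < r.+1 -> index (nth 0 t i) t = i.
  by move=> ir; rewrite index_uniq ?st ?uniq_ltn_sorted.
have <- : nth 0 t u.-1 = x by rewrite tn ltnn eqxx.
rewrite xi; last by lia.
congr rcons; last by lia.
apply: (@eq_from_nth _ 0); first by rewrite size_map size_cat !size_iota sa; lia.
move=> i; rewrite size_map sa => ir; rewrite (nth_map 0) ?sa // nth_cat size_iota.
case: ltnP => ui.
  have -> : nth 0 a i = nth 0 t i by rewrite tn ui.
  by rewrite xi ?nth_iota; lia.
have -> : nth 0 a i = nth 0 t i.+1.
  rewrite tn; have -> : (i.+1 < u.-1) = false by lia.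
  by have -> : (i.+1 == u.-1) = false by lia.
by rewrite xi ?nth_iota; lia.
Qed.

(** Ranks are indices in a sorted list, so comparisons survive; this lets inequalities be read off
    an equality of standardizations. *)
Lemma standardize_mono (s : seq nat) i j : i < size s -> j < size s ->
  (nth 0 (standardize s) i < nth 0 (standardize s) j) = (nth 0 s i < nth 0 s j).
Proof.
move=> si sj; rewrite !(nth_map 0) // ltnS.
set t := sort leq (undup s).
have tS : sorted ltn t.
  by rewrite ltn_sorted_uniq_leq sort_uniq undup_uniq (sort_sorted leq_total).
have mt y : y \in s -> y \in t by rewrite mem_sort mem_undup.
rewrite -{2}(nth_index 0 (mt _ (mem_nth 0 si))).
rewrite -{2}(nth_index 0 (mt _ (mem_nth 0 sj))).
by rewrite ltn_nth_sorted ?index_mem // mt ?mem_nth.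
Qed.

(** * Occurrences as systems of inequalities *)

Definition gap_occurrence (r u : nat) (w : seq nat) : Prop :=
  exists p q, [/\ p + r <= q, q < size w,
    forall i, i.+1 < r -> nth 0 w (p + i) < nth 0 w (p + i).+1,
    nth 0 w (p + u.-2) < nth 0 w q & nth 0 w q < nth 0 w (p + u.-1)].

Lemma nth_gap_pattern r u i : 2 <= u <= r -> i < r ->
  nth 0 (gap_pattern r u).1 i = if i < u.-1 then i.+1 else i.+2.
Proof.
move=> ur ir; rewrite nth_cat size_iota; case: ltnP => ui; rewrite nth_iota; lia.
Qed.

Lemma size_gap_pattern r u : 0 < u <= r -> size (gap_pattern r u).1 = r.
Proof. by rewrite size_cat !size_iota; lia. Qed.

Lemma standardize_gap_pattern r u : 2 <= u <= r ->
  standardize (rcons (gap_pattern r u).1 (gap_pattern r u).2) =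
  rcons (gap_pattern r u).1 (gap_pattern r u).2.
Proof.
move=> ur; have sg : size (gap_pattern r u).1 = r.
  by rewrite size_gap_pattern; lia.
rewrite (standardize_rcons_gap sg ur) //=.
- apply/(sortedP 0) => i; rewrite sg => ir.
  by rewrite !nth_gap_pattern //; [repeat case: ifP; lia | lia].
- by rewrite !nth_gap_pattern //; [repeat case: ifP; lia | lia | lia].
Qed.

Lemma order_isomorphic_gapP r u (a : seq nat) x : 2 <= u <= r -> size a = r ->
  reflect (sorted ltn a /\ nth 0 a u.-2 < x < nth 0 a u.-1)
    (order_isomorphic (rcons a x) (rcons (gap_pattern r u).1 (gap_pattern r u).2)).
Proof.
move=> ur sa; have sg : size (gap_pattern r u).1 = r.
  by rewrite size_gap_pattern; lia.
rewrite /order_isomorphic standardize_gap_pattern //.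
apply: (iffP eqP) => [E|[ss xb]]; last exact: (standardize_rcons_gap sa).
(* Equal standardizations force the same comparisons at all positions, index [r] being that of the
   detached letter. *)
have M i j : i <= r -> j <= r ->
    (nth 0 (rcons a x) i < nth 0 (rcons a x) j) =
    (nth 0 (rcons (gap_pattern r u).1 u) i < nth 0 (rcons (gap_pattern r u).1 u) j).
  by move=> ir jr; rewrite -standardize_mono ?size_rcons ?sa // E.
have ax i : i < r -> nth 0 (rcons a x) i = nth 0 a i.
  by move=> ir; rewrite nth_rcons sa ir.
have gx i : i < r -> nth 0 (rcons (gap_pattern r u).1 u) i = if i < u.-1 then i.+1 else i.+2.
  by move=> ir; rewrite nth_rcons sg ir nth_gap_pattern.
have axr : nth 0 (rcons a x) r = x by rewrite nth_rcons sa ltnn eqxx.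
have gxr : nth 0 (rcons (gap_pattern r u).1 u) r = u by rewrite nth_rcons sg ltnn eqxx.
split.
  apply/(sortedP 0) => i; rewrite sa => ir.
  rewrite /= -(ax i) -?(ax i.+1) ?M; try lia.
  by rewrite !gx; try lia; repeat case: ifP; lia.
have := M u.-2 r; have := M r u.-1.
rewrite axr gxr !ax ?gx; try lia.
by repeat case: ifP; lia.
Qed.

Lemma occursP r u w : 2 <= u <= r ->
  reflect (gap_occurrence r u w) (occurs (gap_pattern r u) w).
Proof.
move=> ur; rewrite /occurs size_gap_pattern; last by lia.
have sz p : p + r <= size w -> size (take r (drop p w)) = r.
  by move=> h; rewrite size_takel ?size_drop; lia.
have nt p i : i < r -> nth 0 (take r (drop p w)) i = nth 0 w (p + i).
  by move=> h; rewrite nth_take // nth_drop.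
apply: (iffP existsP) => [[p /existsP[q /andP[pq]]]|[p [q [pq qw inc l1 l2]]]].
  have pw : p + r <= size w by have := ltn_ord q; lia.
  case/(order_isomorphic_gapP _ ur (sz _ pw)) => ss.
  rewrite !nt; try lia.
  case/andP=> l1 l2; exists p, q; split=> // i ir.
  have := (sortedP 0 ss) i; rewrite sz // !nt ?addnS; lia.
have pw : p < size w by lia.
exists (Ordinal pw); apply/existsP; exists (Ordinal qw); rewrite /= pq /=.
apply/(order_isomorphic_gapP _ ur); first by rewrite sz; lia.
rewrite !nt ?l1 ?l2; try lia.
split=> //; apply/(sortedP 0) => i; rewrite sz; last by lia.
by move=> ir; have := inc _ ir; rewrite /= !nt ?addnS; lia.
Qed.

(** * Enumerating words by increasing runs *)

Fixpoint subseqs (T : Type) (s : seq T) : seq (seq T) :=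
  if s is x :: s' then map (cons x) (subseqs s') ++ subseqs s' else [:: [::]].

Lemma map_subseqs (T U : Type) (f : T -> U) (s : seq T) :
  subseqs (map f s) = map (map f) (subseqs s).
Proof.
elim: s => //= x s IH; rewrite IH map_cat -!map_comp.
by congr cat; apply: eq_map.
Qed.

Lemma mem_subseqs (T : eqType) (s a : seq T) : (a \in subseqs s) = subseq a s.
Proof.
elim: s a => [|x s IH] a; first by rewrite inE subseq0.
rewrite mem_cat IH; case: a => [|y a] /=; first by rewrite !sub0seq orbT.
case: eqP => [->|ne].
  rewrite mem_map ?IH => [|b c [] //].
  by apply/orb_idr => /(subseq_trans _) -> //; apply: subseq_cons.
by rewrite orb_idl // => /mapP[b _ [yx]]; case: ne.
Qed.

Lemma uniq_subseqs (T : eqType) (s : seq T) : uniq s -> uniq (subseqs s).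
Proof.
elim: s => //= x s IH /andP[xs us]; rewrite cat_uniq IH // andbT.
rewrite map_inj_uniq ?IH => [|//|b c [] //]; rewrite /=.
apply/hasPn => a; rewrite mem_subseqs => /mem_subseq as_.
by apply/negP => /mapP[b _ ab]; case/negP: xs; apply: as_; rewrite ab mem_head.
Qed.

(** A sorted [a] with letters in [s] is [s] filtered by membership in [a]. Hence the increasing runs
    over a sorted alphabet are exactly its subsequences, as [words] assumes. *)
Lemma subseq_sorted_ltn (s a : seq nat) : sorted ltn s ->
  subseq a s = sorted ltn a && all (mem s) a.
Proof.
move=> ss; apply/idP/andP => [as_|[sa /allP as_]].
  by split; [apply: subseq_sorted ss => //; apply: ltn_trans
            | apply/allP; apply: mem_subseq].
suff -> : a = [seq x <- s | x \in a] by apply: filter_subseq.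
apply: eq_sorted_ltn => //; first exact: (sorted_filter ltn_trans).
by move=> x; rewrite mem_filter; apply/idP/andP => [xa|[]//]; split=> //; apply: as_.
Qed.

(* The forbidden gaps of a run are adjacent, so together they form an interval
   deprived of the letters of the run. *)
Definition removed (r u : nat) (A : seq nat) (x : nat) : bool :=
  [&& r <= size A, x \notin A, nth 0 A u.-2 < x
    & x < nth 0 A (size A - r + u.-1)].

(* The words of length n over L with first letter at most c that avoid the
   pattern, listed by their first maximal increasing run; f is a bound on n that
   makes the recursion structural. *)
Fixpoint words (r u f n : nat) (L : seq nat) (c : nat) : seq (seq nat) :=
  if f is f'.+1 then
    if n is 0 then [:: [::]] else
    [seq A ++ w | A <- [seq A <- subseqs L | 0 < size A <= n & head 0 A <= c],
                  w <- words r u f' (n - size A)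
                         [seq x <- L | ~~ removed r u A x] (last 0 A)]
  else if n is 0 then [:: [::]] else [::].

(* Since [head 0 [::] = 0], the last condition is void when [w'] is empty. *)
Lemma initial_run (w : seq nat) : w != [::] ->
  exists A w', [/\ w = A ++ w', A != [::], sorted ltn A & head 0 w' <= last 0 A].
Proof.
elim: w => // x w IH _; case: w IH => [_|y w /(_ isT)[A [w' [E A0 sA hA]]]].
  by exists [:: x], [::].
case: (ltnP x y) => xy; last by exists [:: x], (y :: w).
exists (x :: A), w'; rewrite E; split=> //.
  by case: A A0 sA E {hA} => // z A _ /= -> [<- _]; rewrite xy.
by case: A A0 hA {sA E}.
Qed.

(** * Correctness of the enumeration *)

(** A window of ascents cannot cross the boundary, which is not an ascent. If it lies inside [A],
    the later letter lies in [w], and sliding the window along [A] yields exactly the gaps collected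
    in [removed]. *)
Lemma gap_occurrence_cat r u A w : 2 <= u <= r ->
  sorted ltn A -> A != [::] -> head 0 w <= last 0 A ->
  gap_occurrence r u (A ++ w) <-> gap_occurrence r u w \/ has (removed r u A) w.
Proof.
move=> ur sA A0 hw; set m := size A.
have m0 : 0 < m by rewrite lt0n size_eq0.
have nA i : i < m -> nth 0 (A ++ w) i = nth 0 A i by move=> im; rewrite nth_cat im.
have nw i : nth 0 (A ++ w) (m + i) = nth 0 w i.
  by rewrite nth_cat ltnNge leq_addr /= addKn.
have Alt i j : i < m -> j < m -> (nth 0 A i < nth 0 A j) = (i < j).
  by move=> im jm; apply: ltn_nth_sorted.
have Aeq i j : i < m -> j < m -> (nth 0 A i == nth 0 A j) = (i == j).
  by move=> im jm; apply: eq_nth_sorted.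
split=> [[p [q [pq qs inc l1 l2]]]|[[p [q [pq qs inc l1 l2]]]|]].
- rewrite size_cat -/m in qs.
  case: (leqP m p) => pm.
    left; exists (p - m), (q - m).
    have N i : nth 0 w (p - m + i) = nth 0 (A ++ w) (p + i).
      by rewrite -nw; congr nth; lia.
    have Nq : nth 0 w (q - m) = nth 0 (A ++ w) q by rewrite -nw; congr nth; lia.
    split; rewrite ?N ?Nq //; try lia.
    by move=> i ir; rewrite -addnS !N addnS; apply: inc.
  have pr : p + r <= m.
    (* A crossing window would contain the step from [last 0 A] to [head 0 w]. *)
    rewrite leqNgt; apply/negP => mp.
    have := inc (m.-1 - p); have -> : p + (m.-1 - p) = m.-1 by lia.
    have lA : nth 0 A m.-1 = last 0 A by apply: nth_last.
    have nm : nth 0 (A ++ w) m = head 0 w by rewrite -nth0 -nw addn0.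
    by rewrite nA ?prednK // lA nm; lia.
  right; have mq : m <= q.
    (* A letter of [A] after the window would exceed every letter of the window, against [l2]. *)
    rewrite leqNgt; apply/negP => qm; move: l2; rewrite !nA ?Alt; lia.
  have Nq : nth 0 w (q - m) = nth 0 (A ++ w) q by rewrite -nw; congr nth; lia.
  rewrite -Nq nA in l1; last lia.
  rewrite -Nq nA in l2; last lia.
  apply/(has_nthP 0); exists (q - m); first lia.
  apply/and4P; split; first lia.
  + apply/(nthP 0) => -[j jm E]; rewrite -E !Alt // in l1 l2; lia.
  + by apply: leq_ltn_trans l1; rewrite leqNgt Alt; lia.
  + by apply: leq_trans l2 _; rewrite leqNgt Alt; lia.
- exists (m + p), (m + q); rewrite -!addnA !nw size_cat; split=> //; try lia.
  by move=> i ir; rewrite -addnA -addnS !nw; apply: inc.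
- case/(has_nthP 0) => q qs /and4P[rm xA l1 l2].
  set x := nth 0 w q in xA l1 l2.
  have hx : has (ltn x) A.
    by apply/(has_nthP 0); eexists; last exact: l2; lia.
  (* The first letter of [A] above [x] has index [j]; starting the window at [j - u.-1] makes it the
     [u]-th letter. The bounds [uj] and [ju] make the window fit inside [A]. *)
  set j := find (ltn x) A.
  have jm : j < m by rewrite -has_find.
  have xj : x < nth 0 A j by apply: (nth_find 0 hx).
  have bj i : i < j -> nth 0 A i < x.
    move=> ij; have im : i < m by apply: ltn_trans jm.
    have := before_find 0 ij => /= /negbT; rewrite -leqNgt leq_eqVlt => /orP[/eqP E|//].
    by rewrite -E mem_nth in xA.
  have ju : j <= m - r + u.-1.
    rewrite leqNgt; apply/negP => /bj; rewrite -/m in l2; lia.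
  have uj : u.-2 < j.
    by rewrite -Alt //; [lia | lia].
  exists (j - u.-1), (m + q); rewrite nw -/x size_cat; split; try lia.
  + move=> i ir; rewrite !nA ?Alt; lia.
  + by rewrite nA ?bj; lia.
  + have -> : j - u.-1 + u.-1 = j by lia.
    by rewrite nA.
Qed.

Lemma wordsLP r u f n L c (w : seq nat) : sorted ltn L ->
  w \in words r u f.+1 n.+1 L c <->
  exists A v : seq nat,
    [/\ 0 < size A <= n.+1, head 0 A <= c, sorted ltn A && all (mem L) A,
        v \in words r u f (n.+1 - size A)
                [seq x <- L | ~~ removed r u A x] (last 0 A)
      & w = A ++ v].
Proof.
move=> sL; split=> [/allpairsPdep[A [v [/[!mem_filter] /andP[/andP[szA hA]]]]]|].
  by rewrite mem_subseqs subseq_sorted_ltn // => sA vw ->; exists A, v.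
move=> [A [v [szA hA sA vw ->]]]; apply/allpairsPdep; exists A, v; split=> //.
by rewrite mem_filter mem_subseqs subseq_sorted_ltn // szA hA.
Qed.

(** Induction on the first run: the bound [last 0 A] on the next letter makes [A] maximal, and the
    smaller alphabet rules out the second alternative of [gap_occurrence_cat]. *)
Lemma mem_words r u f n L c (w : seq nat) : 2 <= u <= r -> n <= f -> sorted ltn L ->
  w \in words r u f n L c <->
  [/\ size w = n, all (mem L) w, head 0 w <= c & ~ gap_occurrence r u w].
Proof.
move=> ur; elim: f n L c w => [|f IH] n L c w nf sL.
  have -> : n = 0 by lia.
  rewrite /= inE; split=> [/eqP ->|[/eqP]]; last by rewrite size_eq0.
  by split=> // -[p [q [_]]].
case: n nf => [|n] nf.
  rewrite /= inE; split=> [/eqP ->|[/eqP]]; last by rewrite size_eq0.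
  by split=> // -[p [q [_]]].
rewrite wordsLP //; have sL' A : sorted ltn [seq x <- L | ~~ removed r u A x].
  exact: (sorted_filter ltn_trans).
have allL' A v : all (mem [seq x <- L | ~~ removed r u A x]) v =
                 all (mem L) v && ~~ has (removed r u A) v.
  rewrite -all_predC -all_predI; apply: eq_all => x /=.
  by rewrite mem_filter andbC.
split=> [[A [v [/andP[A1 An] hA /andP[sA AL]]]]|].
  have nA : n.+1 - size A <= f by lia.
  move/(IH _ _ _ _ nA (sL' A)); rewrite allL' => -[szv /andP[vL nr] hv nv] ->.
  have A0 : A != [::] by rewrite -size_eq0 -lt0n.
  split.
  - by rewrite size_cat; lia.
  - by rewrite all_cat AL.
  - by case: (A) A0 hA.
  - by rewrite gap_occurrence_cat // => -[//|]; apply/negP.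
move=> [sw wL hw nw]; have [|A [v [E A0 sA hv]]] := @initial_run w.
  by rewrite -size_eq0 sw.
rewrite {w}E gap_occurrence_cat // in sw wL hw nw *.
rewrite all_cat in wL; case/andP: wL => AL vL; rewrite size_cat in sw.
have A1 : 0 < size A by rewrite lt0n size_eq0.
exists A, v; split=> //; first by apply/andP; lia.
- by case: (A) A0 hw.
- by rewrite sA.
apply/IH => //; first by lia.
rewrite allL' vL /=; split=> //; first by lia.
  by apply/negP => h; apply: nw; right.
by move=> h; apply: nw; left.
Qed.

(** If [A] were shorter than [B], the letter of [B] after its copy of [A] would be [head 0 v], at
    most [last 0 A], so [B] would not increase. *)
Lemma run_cat_inj (A B v w : seq nat) :
  sorted ltn A -> sorted ltn B -> A != [::] -> B != [::] ->
  head 0 v <= last 0 A -> head 0 w <= last 0 B -> A ++ v = B ++ w ->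
  A = B /\ v = w.
Proof.
wlog le : A B v w / size A <= size B.
  move=> H; case: (leqP (size A) (size B)) => [h|/ltnW h] sA sB A0 B0 hA hB E.
    exact: H.
  by have [] := H B A w v h.
move=> sA sB A0 B0 hv hw E.
case: (ltnP (size A) (size B)) => [lt|ge]; last first.
  have eqs : size A = size B by lia.
  by move/eqP: E; rewrite eqseq_cat // => /andP[/eqP -> /eqP ->].
have A1 : 0 < size A by rewrite lt0n size_eq0.
have e1 : nth 0 B (size A) = head 0 v.
  have : nth 0 (A ++ v) (size A) = nth 0 (B ++ w) (size A) by rewrite E.
  by rewrite !nth_cat ltnn lt subnn nth0.
have e2 : nth 0 B (size A).-1 = last 0 A.
  have : nth 0 (A ++ v) (size A).-1 = nth 0 (B ++ w) (size A).-1 by rewrite E.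
  by rewrite !nth_cat prednK // leqnn le nth_last.
have : nth 0 B (size A).-1 < nth 0 B (size A) by rewrite ltn_nth_sorted //; lia.
by rewrite e1 e2; lia.
Qed.

(** Makes [size] count words: a word determines its first run and its remainder. *)
Lemma uniq_words r u f n L c : 2 <= u <= r -> n <= f -> sorted ltn L ->
  uniq (words r u f n L c).
Proof.
move=> ur; elim: f n L c => [|f IH] [|n] L c nf sL //.
rewrite /words -/words.
have sL' A : sorted ltn [seq x <- L | ~~ removed r u A x].
  exact: (sorted_filter ltn_trans).
apply: allpairs_uniq_dep.
- by rewrite filter_uniq // uniq_subseqs // uniq_ltn_sorted.
- move=> A; rewrite mem_filter => /andP[/andP[/andP[A0 _] _] _].
  by apply: IH => //; rewrite leq_subLR (leq_trans nf) // -add1n leq_add2r.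
have H (A v : seq nat) : A \in [seq A <- subseqs L | 0 < size A <= n.+1 & head 0 A <= c] ->
    v \in words r u f (n.+1 - size A) [seq x <- L | ~~ removed r u A x] (last 0 A) ->
    [/\ sorted ltn A, A != [::] & head 0 v <= last 0 A].
  rewrite mem_filter mem_subseqs subseq_sorted_ltn // => /andP[/andP[/andP[A0 _] _]] /andP[sA _].
  have nA : n.+1 - size A <= f by lia.
  by move/(mem_words _ _ ur nA (sL' A)) => -[_ _ hv _]; split=> //; rewrite -size_eq0 -lt0n.
move=> p q /allpairsPdep[A [v [AL vA ->]]] /allpairsPdep[B [w [BS wB ->]]] /= E.
have [sA A0 hA] := H _ _ AL vA; have [sB B0 hB] := H _ _ BS wB.
by have [-> ->] := run_cat_inj sA sB A0 B0 hA hB E.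
Qed.

(** * Counting the letters that stay available *)

(** The integers strictly between the two bounds number their difference minus one, and [size a - r]
    of them are entries of [a]. Adding on the left avoids further truncated subtractions. *)
Lemma count_removed r u s a : 2 <= u <= r -> r <= size a ->
  sorted ltn a -> all (ltn^~ s) a ->
  count (removed r u a) (iota 0 s) + (size a - r).+1 =
  nth 0 a (size a - r + u.-1) - nth 0 a u.-2.
Proof.
move=> ur ra sa /allP as_.
set x := u.-2; set y := size a - r + u.-1.
have y_lt : y < size a by lia.
have xy : x < y by lia.
have axy : nth 0 a x < nth 0 a y by rewrite ltn_nth_sorted //; lia.
have ays : nth 0 a y < s by apply: as_; rewrite mem_nth.
pose I := [pred i | nth 0 a x < i < nth 0 a y].
have e1 : count I (iota 0 s) = (nth 0 a y - nth 0 a x).-1.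
  rewrite -size_filter -[RHS](size_iota (nth 0 a x).+1); apply: perm_size.
  apply: uniq_perm; rewrite ?filter_uniq ?iota_uniq // => i.
  by rewrite mem_filter !mem_iota /=; lia.
have e2 : count [predI I & mem a] (iota 0 s) = (size a - r).
  rewrite -size_filter -[RHS](size_iota x.+1) -[RHS](size_map (nth 0 a)).
  apply: perm_size; apply: uniq_perm; first by rewrite filter_uniq ?iota_uniq.
    rewrite map_inj_in_uniq ?iota_uniq // => i j; rewrite !mem_iota => hi hj /eqP.
    by rewrite eq_nth_sorted //; [move/eqP | lia | lia].
  move=> i; rewrite mem_filter mem_iota /=; apply/andP/mapP => [[/andP[l ia] _]|[j]].
    exists (index i a); last by rewrite nth_index.
    have ii : index i a < size a by rewrite index_mem.
    by move: l; rewrite inE -[i](nth_index 0 ia) !ltn_nth_sorted ?nth_index ?mem_iota //; lia.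
  rewrite mem_iota => hj ->; have jl : j < size a by lia.
  have ja : nth 0 a j \in a by rewrite mem_nth.
  have js : nth 0 a j < s by apply: as_.
  by rewrite !inE ja !ltn_nth_sorted //; lia.
have e3 : count (removed r u a) (iota 0 s) =
          count [predI I & predC (mem a)] (iota 0 s).
  by apply: eq_count => i /=; rewrite /removed ra /= andbC.
have := count_predC (mem a) [seq i <- iota 0 s | I i].
rewrite size_filter !count_filter.
have -> : count [predI mem a & I] (iota 0 s) = size a - r.
  by rewrite -e2; apply: eq_count => i /=; rewrite andbC.
have -> : count [predI predC (mem a) & I] (iota 0 s) = count (removed r u a) (iota 0 s).
  by rewrite e3; apply: eq_count => i /=; rewrite andbC.
by rewrite e1; lia.
Qed.

Lemma map_nth_iota_size (L : seq nat) : [seq nth 0 L i | i <- iota 0 (size L)] = L.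
Proof. by rewrite map_nth_iota0 ?take_size. Qed.

(** [removed] involves only a length, membership and comparisons, so it is transported by the
    increasing map [nth 0 L]; runs can be replaced by sequences of positions in [L]. *)
Lemma removed_nth r u L a i : 2 <= u <= r ->
  sorted ltn L -> all (ltn^~ (size L)) a -> i < size L ->
  removed r u (map (nth 0 L) a) (nth 0 L i) = removed r u a i.
Proof.
move=> ur sL /allP aS iS; rewrite /removed size_map.
case: (leqP r (size a)) => //= ra.
have H k : k < size a -> nth 0 a k < size L by move=> ka; apply/aS/mem_nth.
have u1 : u.-2 < size a by lia.
have u2 : size a - r + u.-1 < size a by lia.
rewrite !(nth_map 0) // !ltn_nth_sorted ?H //.
congr (~~ _ && _); apply/mapP/idP => [[j ja /eqP]|ia]; last by exists i.
by rewrite eq_nth_sorted //; [move/eqP-> | apply: aS].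
Qed.

(** The run enters only through its length and one difference of entries, which is what the exchange
    of gaps has to match. *)
Lemma size_kept r u L a : 2 <= u <= r ->
  sorted ltn L -> sorted ltn a -> all (ltn^~ (size L)) a ->
  size [seq x <- L | ~~ removed r u (map (nth 0 L) a) x] =
  if r <= size a then
    size L + (size a - r).+1 - (nth 0 a (size a - r + u.-1) - nth 0 a u.-2)
  else size L.
Proof.
move=> ur sL sa aS; rewrite size_filter.
rewrite -[X in count _ X](map_nth_iota_size L) count_map.
rewrite (@eq_in_count _ _ (predC (removed r u a))); last first.
  by move=> i; rewrite mem_iota => iS /=; rewrite removed_nth.
have E := count_predC (removed r u a) (iota 0 (size L)); rewrite size_iota in E.
apply/eqP; rewrite -(eqn_add2l (count (removed r u a) (iota 0 (size L)))) E.
have := count_size (removed r u a) (iota 0 (size L)); rewrite size_iota {E}.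
case: (leqP r (size a)) => ra; first by have := count_removed ur ra sa aS; lia.
rewrite (@eq_count _ (removed r u a) pred0) ?count_pred0 // => i.
by rewrite /removed leqNgt ra.
Qed.

Lemma last_map_nth (L a : seq nat) : a != [::] ->
  last 0 (map (nth 0 L) a) = nth 0 L (last 0 a).
Proof. by case: a => //= x a _; rewrite last_map. Qed.

(** Forbidden gaps lie below the last letter of the run, so no letter above it is lost. *)
Lemma count_above_last r u L a : 2 <= u <= r ->
  sorted ltn L -> sorted ltn a -> all (ltn^~ (size L)) a -> a != [::] ->
  count (ltn (last 0 (map (nth 0 L) a)))
    [seq x <- L | ~~ removed r u (map (nth 0 L) a) x] = size L - (last 0 a).+1.
Proof.
move=> ur sL sa aS a0; rewrite last_map_nth // count_filter.
rewrite -[X in count _ X](map_nth_iota_size L) count_map.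
have a1 : 0 < size a by rewrite lt0n size_eq0.
have laS : last 0 a < size L.
  by move/allP: aS; apply; rewrite -nth_last mem_nth // prednK.
rewrite -[RHS](size_iota (last 0 a).+1) -size_filter; apply: perm_size.
apply: uniq_perm; rewrite ?filter_uniq ?iota_uniq // => i.
rewrite mem_filter !mem_iota /=.
case: (ltnP i (size L)) => iS; last by lia.
rewrite ltn_nth_sorted ?removed_nth //.
case: ltnP => li /=; last by lia.
suff -> : removed r u a i = false by lia.
apply/negbTE/negP => /and4P[ra _ _]; rewrite ltnNge => /negP; apply.
apply: leq_trans (ltnW li); rewrite -nth_last leqNgt ltn_nth_sorted //; lia.
Qed.

(** The letters at most [c] form a prefix of [L], so a bound on the first letter matters only
    through the number of letters above it. *)
Lemma leq_nth_count (L : seq nat) c i : sorted ltn L -> i < size L ->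
  (nth 0 L i <= c) = (i + count (ltn c) L < size L).
Proof.
move=> sL iS; rewrite -(count_predC (leq^~ c) L).
have -> : count (predC (leq^~ c)) L = count (ltn c) L.
  by apply: eq_count => x /=; rewrite ltnNge.
rewrite ltn_add2r.
elim: L sL i iS => //= x L IH sL i iS.
have Z : c < x -> count (leq^~ c) L = 0.
  move=> cx; apply/eqP; rewrite -leqn0 leqNgt -has_count.
  apply/hasPn => y yL; rewrite -ltnNge; apply: ltn_trans cx _.
  by move/(order_path_min ltn_trans)/allP: sL; apply.
case: i iS => [|i] iS /=; first by case: (leqP x c) => [|/Z ->].
rewrite IH ?(path_sorted sL) //.
by case: (leqP x c) => [_|/Z ->] /=; rewrite ?add1n ?ltnS ?add0n.
Qed.

(** * Exchanging two gaps of an increasing sequence *)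

(* Exchanges the gap between the entries [i.-1] and [i] with the one between
   the entries [j.-1] and [j]. *)
Definition swap_gaps (i j : nat) (a : seq nat) : seq nat :=
  mkseq (fun l => if i <= l < j
                  then nth 0 a l + (nth 0 a j - nth 0 a j.-1)
                       - (nth 0 a i - nth 0 a i.-1)
                  else nth 0 a l) (size a).

Lemma size_swap_gaps i j a : size (swap_gaps i j a) = size a.
Proof. exact: size_mkseq. Qed.

Lemma nth_swap_gaps i j a l : l < size a ->
  nth 0 (swap_gaps i j a) l =
  if i <= l < j then nth 0 a l + (nth 0 a j - nth 0 a j.-1)
                     - (nth 0 a i - nth 0 a i.-1)
  else nth 0 a l.
Proof. exact: nth_mkseq. Qed.

Lemma nth_swap_gaps_in i j a l : l < size a -> i <= l < j ->
  nth 0 (swap_gaps i j a) l =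
  nth 0 a l + (nth 0 a j - nth 0 a j.-1) - (nth 0 a i - nth 0 a i.-1).
Proof. by move=> la ij; rewrite nth_swap_gaps // ij. Qed.

Lemma nth_swap_gaps_out i j a l : l < size a -> ~~ (i <= l < j) ->
  nth 0 (swap_gaps i j a) l = nth 0 a l.
Proof. by move=> la /negbTE ij; rewrite nth_swap_gaps // ij. Qed.

Lemma leq_nth_sorted (s : seq nat) i j :
  sorted ltn s -> i <= j -> j < size s -> nth 0 s i <= nth 0 s j.
Proof. by move=> ss ij js; rewrite leqNgt ltn_nth_sorted //; lia. Qed.

Section SwapGaps.

Variables (i j : nat) (a : seq nat).
Hypotheses (sa : sorted ltn a) (i_gt0 : 0 < i) (ij : i < j) (ja : j < size a).

Let di : nth 0 a i.-1 < nth 0 a i.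
Proof. by rewrite ltn_nth_sorted //; lia. Qed.

Let dj : nth 0 a j.-1 < nth 0 a j.
Proof. by rewrite ltn_nth_sorted //; lia. Qed.

(** The subtraction never truncates, since entries from index [i] on are at least the gap ending at
    [i]. The gaps ending at [i] and [j] are traded, the others kept. *)
Lemma sorted_swap_gaps : sorted ltn (swap_gaps i j a).
Proof.
apply/(sortedP 0) => l; rewrite size_swap_gaps => la; rewrite /= !nth_swap_gaps //; last lia.
have dl : nth 0 a l < nth 0 a l.+1 by rewrite ltn_nth_sorted //; lia.
case: ifP => h1; case: ifP => h2 //.
- have : nth 0 a i <= nth 0 a l by apply: leq_nth_sorted => //; lia.
  lia.
- have -> : l.+1 = j by lia.
  have e : l = j.-1 by lia.
  have : nth 0 a i <= nth 0 a l by apply: leq_nth_sorted => //; lia.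
  by rewrite e; lia.
- have e : l = i.-1 by lia.
  have -> : l.+1 = i by lia.
  by rewrite e; lia.
Qed.

Lemma swap_gapsK : swap_gaps i j (swap_gaps i j a) = a.
Proof.
apply: (@eq_from_nth _ 0); rewrite !size_swap_gaps // => l la.
rewrite nth_swap_gaps ?size_swap_gaps //.
(* The two gaps of the swapped sequence: entries [j] and [i.-1] are untouched, [j.-1] and [i] are
   shifted. *)
rewrite (@nth_swap_gaps_out _ _ _ j) ?(@nth_swap_gaps_in _ _ _ j.-1)
  ?(@nth_swap_gaps_in _ _ _ i) ?(@nth_swap_gaps_out _ _ _ i.-1); try lia.
case: ifP => h; last by rewrite nth_swap_gaps_out //; lia.
rewrite nth_swap_gaps_in //.
have : nth 0 a i <= nth 0 a l by apply: leq_nth_sorted => //; lia.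
have : nth 0 a i <= nth 0 a j.-1 by apply: leq_nth_sorted => //; lia.
lia.
Qed.

Lemma head_swap_gaps : head 0 (swap_gaps i j a) = head 0 a.
Proof. by rewrite -!nth0 nth_swap_gaps_out //; lia. Qed.

Lemma last_swap_gaps : last 0 (swap_gaps i j a) = last 0 a.
Proof. by rewrite -!nth_last size_swap_gaps nth_swap_gaps_out //; lia. Qed.

(** Entry [j] stays, while entry [i] becomes [nth 0 a i.-1] plus the gap formerly ending at [j]. *)
Lemma swap_gaps_diff :
  nth 0 (swap_gaps i j a) j - nth 0 (swap_gaps i j a) i =
  nth 0 a j.-1 - nth 0 a i.-1.
Proof.
rewrite nth_swap_gaps_out ?nth_swap_gaps_in //; lia.
Qed.

Lemma all_swap_gaps s : all (ltn^~ s) a -> all (ltn^~ s) (swap_gaps i j a).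
Proof.
move=> /allP as_; apply/allP => x /(nthP 0)[l]; rewrite size_swap_gaps => la <-.
have h : last 0 a < s by apply: as_; rewrite -nth_last mem_nth //; case: (a) ja.
rewrite /=; apply: leq_ltn_trans h; rewrite -last_swap_gaps -nth_last.
by apply: leq_nth_sorted sorted_swap_gaps _ _; rewrite size_swap_gaps; lia.
Qed.

End SwapGaps.

(** * A permutation of the runs *)

(** In a run of length [m], the forbidden gaps span indices [u.-2] to [m - r + u.-1], shifted by one
    for [u.+1]: the gap ending at [u.-1] leaves, the one ending at [m - r + u] enters. Runs shorter
    than [r] forbid nothing. *)
Definition run_swap (r u : nat) (a : seq nat) : seq nat :=
  if r <= size a then swap_gaps u.-1 (size a - r + u) a else a.

Section RunSwap.

Variables (r u s : nat).
Hypothesis (ur : 2 <= u < r).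

Let sorted_iota : sorted ltn (iota 0 s). Proof. exact: iota_ltn_sorted. Qed.

Lemma mem_subseqs_iota a :
  (a \in subseqs (iota 0 s)) = sorted ltn a && all (ltn^~ s) a.
Proof.
rewrite mem_subseqs subseq_sorted_ltn //; congr (_ && _).
by apply: eq_all => x; rewrite /= mem_iota.
Qed.

Lemma size_run_swap a : size (run_swap r u a) = size a.
Proof. by rewrite /run_swap; case: ifP => // _; rewrite size_swap_gaps. Qed.

Lemma run_swapP a : a \in subseqs (iota 0 s) ->
  [/\ run_swap r u a \in subseqs (iota 0 s), run_swap r u (run_swap r u a) = a,
      head 0 (run_swap r u a) = head 0 a & last 0 (run_swap r u a) = last 0 a].
Proof.
move=> ain; move: (ain); rewrite mem_subseqs_iota => /andP[sa as_].
have H : size (run_swap r u a) = size a by apply: size_run_swap.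
case: (leqP r (size a)) => ra; last first.
  have E : run_swap r u a = a by rewrite /run_swap leqNgt ra.
  by rewrite !E; split.
have E : run_swap r u a = swap_gaps u.-1 (size a - r + u) a.
  by rewrite /run_swap ra.
have -> : run_swap r u (run_swap r u a) =
          swap_gaps u.-1 (size a - r + u) (run_swap r u a).
  by rewrite {1}/run_swap H ra.
rewrite E.
(* By [2 <= u < r], the shifted entries include neither the first nor the last. *)
have [u1 u2 u3] : [/\ 0 < u.-1, u.-1 < size a - r + u & size a - r + u < size a].
  by split; lia.
rewrite mem_subseqs_iota sorted_swap_gaps // all_swap_gaps //.
by rewrite swap_gapsK // head_swap_gaps // last_swap_gaps.
Qed.

(** An involution of a finite set permutes it; this reindexes sums over runs. *)
Lemma perm_run_swap :
  perm_eq (map (run_swap r u) (subseqs (iota 0 s))) (subseqs (iota 0 s)).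
Proof.
have us : uniq (subseqs (iota 0 s)) by rewrite uniq_subseqs ?iota_uniq.
apply: uniq_perm => //.
  rewrite map_inj_in_uniq // => a b /run_swapP[_ aK _ _] /run_swapP[_ bK _ _] E.
  by rewrite -aK E bK.
move=> a; apply/mapP/idP => [[b /run_swapP[bin _ _ _] ->] //|ain].
by have [bin aK _ _] := run_swapP ain; exists (run_swap r u a).
Qed.

End RunSwap.

(** * Passing from one gap to the next *)

(** Two different alphabets are allowed, because matched runs leave different letters available.
    Runs over both become sequences of positions, paired by [run_swap]. *)
Lemma size_words_swap r u f n L M c d : 2 <= u < r ->
  sorted ltn L -> sorted ltn M -> size L = size M ->
  count (ltn c) L = count (ltn d) M ->
  size (words r u f n L c) = size (words r u.+1 f n M d).
Proof.
move=> ur; elim: f n L M c d => [|f IH] [|n] L M c d sL sM sz ct //.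
rewrite /words -/words !size_allpairs_dep !sumnE !big_map !big_filter.
rewrite -[in subseqs L](map_nth_iota_size L) -[in subseqs M](map_nth_iota_size M) !map_subseqs !big_map -sz.
rewrite -[RHS](perm_big _ (perm_run_swap (size L) ur)) /= big_map.
rewrite big_seq_cond [RHS]big_seq_cond.
have fE a : a \in subseqs (iota 0 (size L)) ->
    [/\ sorted ltn a, all (ltn^~ (size L)) a,
     sorted ltn (run_swap r u a) && all (ltn^~ (size M)) (run_swap r u a), head 0 (run_swap r u a) = head 0 a
     & last 0 (run_swap r u a) = last 0 a].
  move=> ain; have [] := run_swapP ur ain; move: ain.
  by rewrite !mem_subseqs_iota -sz => /andP[-> ->] /andP[-> ->] _ -> ->.
apply: eq_big => [a|a].
  apply: andb_id2l => /fE[sa aL /andP[sb bM] hb _]; rewrite !size_map size_run_swap.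
  (* The empty run is set apart: [head 0] commutes with [map (nth 0 N)] only on nonempty
     sequences. *)
  have [->|a0] := eqVneq a [::]; first by [].
  congr (_ && _).
  have hE N (b : seq nat) : b != [::] -> head 0 (map (nth 0 N) b) = nth 0 N (head 0 b).
    by case: b.
  have b0 : run_swap r u a != [::] by rewrite -size_eq0 size_run_swap size_eq0.
  have haL : head 0 a < size L by case: (a) a0 aL => //= x b _ /andP[].
  by rewrite !hE // hb !leq_nth_count -?sz // ct.
case/andP=> ain /andP[/andP[a0 _] _]; have [sa aL /andP[sb bM] hb lb] := fE _ ain.
rewrite size_map in a0.
have {}a0 : a != [::] by rewrite -size_eq0 -lt0n.
have b0 : run_swap r u a != [::] by rewrite -size_eq0 size_run_swap size_eq0.
have ur1 : 2 <= u <= r by lia.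
have ur2 : 2 <= u.+1 <= r by lia.
rewrite !size_map size_run_swap; apply: IH.
- exact: (sorted_filter ltn_trans).
- exact: (sorted_filter ltn_trans).
- rewrite !size_kept // size_run_swap -sz; case: (leqP r (@size nat a)) => // ra.
  congr (_ - _); rewrite /run_swap ra /=.
  (* The upper index for [u] is one below the exchanged index, the form required by
     [swap_gaps_diff]. *)
  have -> : @size nat a - r + u.-1 = (@size nat a - r + u).-1 by lia.
  by rewrite swap_gaps_diff //; lia.
- by rewrite !count_above_last // lb sz.
Qed.

(** The bound [k] on the first letter is vacuous over [iota 1 k], and the recursion bound is the
    length itself. *)
Lemma num_avoiding_words r u n k : 2 <= u <= r -> 0 < k ->
  num_avoiding (gap_pattern r u) n k = size (words r u n n (iota 1 k) k).
Proof.
move=> ur; case: k => // k _.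
rewrite /num_avoiding cardE -(size_map (@letters n k.+1)).
apply: perm_size; have sI : sorted ltn (iota 1 k.+1) by apply: iota_ltn_sorted.
apply: uniq_perm; last 1 first.
- move=> w; apply/mapP/idP => [[t]|].
    rewrite mem_enum inE => av ->.
    apply/mem_words => //; split.
    + by rewrite size_map size_tuple.
    + apply/allP => x /mapP[i _ ->]; change (i.+1 \in iota 1 k.+1); rewrite mem_iota.
      by have := ltn_ord i; lia.
    + rewrite /letters; case: (tval t) => //= i _; exact: ltn_ord.
    + by move/(occursP _ ur); apply/negP.
  move/(mem_words _ _ ur (leqnn n) sI) => -[sw /allP wI _ nw].
  (* Inverse of [letters]; [inord] never takes its default value, as letters lie between [1] and
     [k.+1]. *)
  have st : size [seq (inord x.-1 : 'I_k.+1) | x <- w] == n by rewrite size_map sw.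
  have E : letters (Tuple st) = w.
    rewrite /letters /= -map_comp; apply: map_id_in => x /wI xI.
    have : x \in iota 1 k.+1 := xI.
    by rewrite mem_iota /= => h; rewrite inordK; lia.
  exists (Tuple st) => //; rewrite mem_enum inE E.
  by apply/negP => /(occursP _ ur).
- rewrite map_inj_uniq ?enum_uniq // => s t E; apply: val_inj.
  by move: E; apply: inj_map => i j [] /val_inj.
- exact: uniq_words.
Qed.

Theorem theorem2p4 (r u v : nat) :
  3 <= r -> 2 <= u <= r -> 2 <= v <= r ->
  wilf_equivalent (gap_pattern r u) (gap_pattern r v).
Proof.
move=> _ ur vr n k k0.
(* Every gap is compared with gap [2], one unit shift at a time. *)
have step w : 2 <= w <= r ->
    num_avoiding (gap_pattern r w) n k = num_avoiding (gap_pattern r 2) n k.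
  elim: w => // w IH wr; case: (ltnP 1 w) => w1; last by have -> : w = 1 by lia.
  have wr1 : 2 <= w < r by lia.
  rewrite -IH ?num_avoiding_words //; try lia.
  by apply/esym/size_words_swap => //; apply: iota_ltn_sorted.
by rewrite !step.
Qed.
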